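(* Let $n=2m$, $m=2m_1$, with $m_1\equiv 1\pmod 2$ and $m_1\geq 3$. Let $\beta$ be a primitive 5-th root of unity in $\mathbb{F}_{16}$. If $b\in\mathbb{F}_{16}\setminus\{\beta^i\mid 1\le i\le 4\}$ and $a\in\mathbb{F}_{2^{m_1}}$, then the Boolean function $f_{a,b}:\mathbb{F}_{2^n}\to\mathbb{F}_2$, $$f_{a,b}(x)=\mathrm{Tr}_1^n(ax^{2^m-1})+\mathrm{Tr}_1^4(bx^{\frac{2^n-1}{5}}),$$ is not a hyper-bent function.
   Context: $\mathrm{Tr}_1^k:\mathbb{F}_{2^k}\to\mathbb{F}_2$ is the absolute trace; $\mathbb{F}_{16}\subset\mathbb{F}_{2^n}$ since $4\mid n$. A Boolean function $f:\mathbb{F}_{2^n}\to\mathbb{F}_2$ is bent if $\sum_{x\in\mathbb{F}_{2^n}}(-1)^{f(x)+\mathrm{Tr}_1^n(wx)}=\pm 2^{n/2}$ for all $w\in\mathbb{F}_{2^n}$; it is hyper-bent if it is bent and, for every integer $i$ with $\gcd(i,2^n-1)=1$, $x\mapsto f(x^i)$ is also bent. *)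

(* Defs.v *)
From HB Require Import structures.
From mathcomp Require Import all_boot all_order all_algebra.

Set Implicit Arguments.
Unset Strict Implicit.
Unset Printing Implicit Defensive.

Import GRing.Theory.
Local Open Scope ring_scope.

Definition subfield_of_order (F : finFieldType) (q : nat) (K : {set F}) : Prop :=
  divring_closed (mem K) /\ #|K| = q.

(* Tr_1^k on the subfield of order 2^k of a field F of characteristic 2.  On
   that subfield the sum below lies in the prime field {0, 1} of F (see
   [Tr1E]), which is identified with 'F_2; other arguments are irrelevant. *)
Definition Tr1 (F : finFieldType) (k : nat) (x : F) : 'F_2 :=
  if \sum_(i < k) x ^+ (2 ^ i) == 0 then 0 else 1.

Lemma Tr1E (F : finFieldType) (k : nat) (x : F) :
  2 \in [pchar F] -> x ^+ (2 ^ k) = x ->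
  (Tr1 k x : nat)%:R = \sum_(i < k) x ^+ (2 ^ i) :> F.
Proof.
move=> ch2 xk; rewrite /Tr1; set s := \sum_(i < k) _.
have ss : s ^+ 2 = s.
  rewrite -[s ^+ 2](pFrobenius_autE ch2) raddf_sum /=.
  under eq_bigr => i _ do rewrite pFrobenius_autE -exprM -expnSr.
  rewrite /s; case: k xk {s} => [|k] xk; first by rewrite !big_ord0.
  by rewrite big_ord_recr big_ord_recl /= xk expr1 addrC.
case: eqP => [-> //|/eqP s0].
by apply: (mulfI s0); rewrite mulr1 -expr2 ss.
Qed.

(* Here #|F| = 2 ^ n with n even, so n./2 is exactly n / 2. *)
Definition bent (n : nat) (F : finFieldType) (f : F -> 'F_2) : Prop :=
  forall w : F,
    let S : int := \sum_(x : F) (-1) ^+ (f x + Tr1 n (w * x))%R in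
    S = 2 ^+ n./2 \/ S = - 2 ^+ n./2.

(* [x ^ i] is the power with integer exponent.  The coprimality hypothesis
   excludes i = 0 when n >= 2, and 0 ^ i = 0 for all other i, including
   negative ones, since 0^-1 = 0. *)
Definition hyper_bent (n : nat) (F : finFieldType) (f : F -> 'F_2) : Prop :=
  bent n f /\
  forall i : int, coprimez i (2 ^+ n - 1) -> bent n (fun x => f (x ^ i)).

Definition fab (n m : nat) (F : finFieldType) (a b x : F) : 'F_2 :=
  Tr1 n (a * x ^+ (2 ^ m - 1)) + Tr1 4 (b * x ^+ ((2 ^ n - 1) %/ 5)).

(* Main.v *)
Require Import Defs.
From HB Require Import structures.
From mathcomp Require Import all_boot all_order all_algebra all_solvable all_field.
From mathcomp Require Import zify ring.

(* Write q = 2 ^ m1 and Q = 2 ^ m = q ^ 2, and let U be the group of (Q+1)-st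
   roots of unity.  Since f_{a,b} is constant on the cosets of F_Q^*, the bent
   condition at w = 0 alone forces the sum of (-1)^f over U, suitably
   reparametrized, to be 1.  Splitting U into the fibres of
   v -> v ^ ((Q+1)/5) gives five partial sums P_0, ..., P_4 of chi(Tr(a v)); as
   a is fixed by x -> x ^ q and q generates (Z/5)^*, P_1 = ... = P_4.
   Counting solutions of quadratic equations over a field and over its
   quadratic extension together yields, for a != 0,
     P_0 + 4 P_1 = t ^ 2 - 2 q   and   5 P_0 = 2 A + t ^ 2 - 2 q
   where t is the (odd) Kloosterman sum of a over F_q and A is the sum of
   chi(Tr(a D_5(c))) over F_Q, with D_5 = c ^ 5 + c ^ 3 + c the Dickson
   polynomial.  The exponent of A is a quadratic form; its radical has at most
   16 elements and is nontrivial already over F_q, because m1 is odd, so that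
   (A/q)^2 is an even square at most 16 and A is one of 0, +-2q, +-4q.  The
   signs chi(Tr_4(b beta ^ i)) determine b, and for the admissible b the
   resulting equations have no solution: one makes 2q and 2q + 1 both squares,
   the others fail modulo 8, 3 or 11, or by sign. *)

Set Implicit Arguments.
Unset Strict Implicit.
Unset Printing Implicit Defensive.

Import Order.TTheory GRing.Theory Num.Theory.
Local Open Scope ring_scope.

(** * Traces and additive characters in characteristic 2 *)

Section Characteristic2.

Variable F : finFieldType.
Hypothesis ch2 : 2 \in [pchar F].

(** When #|F| = 2 ^ n and k divides n, this is the subfield of order 2 ^ k. Fixed points of a
    Frobenius power keep the whole tower inside one field [F]. *)
Definition frobfix k : {set F} := [set x | x ^+ (2 ^ k) == x].

Definition trace k (x : F) : F := \sum_(i < k) x ^+ (2 ^ i).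

Definition chi k (x : F) : int := (-1) ^+ (trace k x != 0).

Lemma addrr_char2 (x : F) : x + x = 0. Proof. exact: addrr_pchar2. Qed.

Lemma two_eq0 : 2%:R = 0 :> F. Proof. exact: pcharf0. Qed.

Lemma oppr_char2 (x : F) : - x = x. Proof. exact: oppr_pchar2. Qed.

Lemma addr_eq0_char2 (x y : F) : (x + y == 0) = (x == y).
Proof. by rewrite -[y in x + y]oppr_char2 subr_eq0. Qed.

Lemma exprD2X (x y : F) i : (x + y) ^+ (2 ^ i) = x ^+ (2 ^ i) + y ^+ (2 ^ i).
Proof.
apply: exprDn_pchar; rewrite pnatX; apply/orP; left.
by rewrite pnatE.
Qed.

Lemma exp2X_inj i : injective (fun x : F => x ^+ (2 ^ i)).
Proof.
move=> x y /eqP; rewrite -addr_eq0_char2 -exprD2X expf_eq0 addr_eq0_char2.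
by case/andP=> _ /eqP.
Qed.

Lemma frobfixE k x : (x \in frobfix k) = (x ^+ (2 ^ k) == x).
Proof. by rewrite inE. Qed.

Lemma frobfix0 k : 0 \in frobfix k.
Proof. by rewrite frobfixE expr0n expn_eq0. Qed.

Lemma frobfix1 k : 1 \in frobfix k.
Proof. by rewrite frobfixE expr1n. Qed.

Lemma frobfixD k x y : x \in frobfix k -> y \in frobfix k -> x + y \in frobfix k.
Proof. by rewrite !frobfixE exprD2X => /eqP-> /eqP->. Qed.

Lemma frobfixM k x y : x \in frobfix k -> y \in frobfix k -> x * y \in frobfix k.
Proof. by rewrite !frobfixE exprMn => /eqP-> /eqP->. Qed.

Lemma frobfixX k x i : x \in frobfix k -> x ^+ i \in frobfix k.
Proof. by rewrite !frobfixE exprAC => /eqP->. Qed.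

Lemma frobfixV k x : x \in frobfix k -> x^-1 \in frobfix k.
Proof. by rewrite !frobfixE exprVn => /eqP->. Qed.

Lemma frobfixS k l : (k %| l)%N -> frobfix k \subset frobfix l.
Proof.
case/dvdnP=> j ->; apply/subsetP => x; rewrite !frobfixE => /eqP xk.
elim: j => [|j /eqP IHj]; first by rewrite mul0n.
by rewrite mulSn expnD exprM xk IHj.
Qed.

Lemma trace0 k : trace k 0 = 0.
Proof. by rewrite /trace big1 // => i _; rewrite expr0n expn_eq0. Qed.

Lemma traceD k x y : trace k (x + y) = trace k x + trace k y.
Proof. by rewrite /trace -big_split; apply: eq_bigr => i _; rewrite exprD2X. Qed.

Lemma trace_sqr k x : trace k (x ^+ 2) = trace k x ^+ 2.
Proof.
rewrite /trace -[RHS](pFrobenius_autE ch2) raddf_sum /=.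
by apply: eq_bigr => i _; rewrite pFrobenius_autE exprAC.
Qed.

Lemma trace_frob k x : x \in frobfix k -> trace k (x ^+ 2) = trace k x.
Proof.
rewrite frobfixE /trace; case: k => [|k] /eqP xk; first by rewrite !big_ord0.
rewrite big_ord_recr big_ord_recl /= -exprM -expnS xk expr1 addrC; congr (_ + _).
by apply: eq_bigr => i _; rewrite -exprM -expnS.
Qed.

Lemma trace01 k x : x \in frobfix k -> (trace k x == 0) || (trace k x == 1).
Proof.
move=> /trace_frob; rewrite trace_sqr => /eqP.
rewrite -subr_eq0 expr2 -[X in _ - X]mulr1 -mulrBr mulf_eq0 subr_eq0.
by [].
Qed.

(** Transitivity of the trace: the terms i and k + i together form the trace of z + z ^ (2 ^ k). *)
Lemma trace_double k z : trace (2 * k) z = trace k (z + z ^+ (2 ^ k)).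
Proof.
rewrite traceD /trace mul2n -addnn big_split_ord /=; congr (_ + _).
by apply: eq_bigr => i _; rewrite expnD exprM.
Qed.

Lemma chi0 k : chi k 0 = 1. Proof. by rewrite /chi trace0 eqxx. Qed.

Lemma chi_sqr1 k x : chi k x * chi k x = 1.
Proof. by rewrite /chi; case: (_ != _). Qed.

Lemma chiD k x y :
  x \in frobfix k -> y \in frobfix k -> chi k (x + y) = chi k x * chi k y.
Proof.
move=> /trace01 hx /trace01 hy; rewrite /chi traceD.
case/orP: hx => /eqP->; case/orP: hy => /eqP->;
  by rewrite ?addrr_char2 ?add0r ?addr0 ?eqxx ?oner_eq0.
Qed.

Lemma chi_frob k x j : x \in frobfix k -> chi k (x ^+ (2 ^ j)) = chi k x.
Proof.
move=> xk; elim: j => [|j IHj]; first by rewrite expr1.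
by rewrite expnSr exprM /chi trace_frob ?frobfixX //; apply: IHj.
Qed.

Lemma chi_double k z : chi (2 * k) z = chi k (z + z ^+ (2 ^ k)).
Proof. by rewrite /chi trace_double. Qed.

Lemma Tr1_chi k x : (-1) ^+ (Tr1 k x) = chi k x :> int.
Proof. by rewrite /Tr1 /chi /trace; case: eqP. Qed.

(** As a polynomial the trace is nonzero of degree at most 2 ^ (k - 1), too small to vanish on 2 ^ k
    points. *)
Lemma chi_onto k :
  (0 < k)%N -> #|frobfix k| = (2 ^ k)%N -> exists2 c, c \in frobfix k & chi k c = -1.
Proof.
case: k => // k _ cardK.
pose p : {poly F} := \sum_(i < k.+1) 'X^(2 ^ i).
have pE x : p.[x] = trace k.+1 x.
  by rewrite /p /trace horner_sum; apply: eq_bigr => i _; rewrite hornerXn.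
have p1 : p`_1 = 1.
  rewrite /p coef_sum big_ord_recl coefXn eqxx big1 ?addr0 // => i _.
  by rewrite coefXn ltn_eqF // -{1}(expn0 2) ltn_exp2l.
have szp : (size p <= (2 ^ k).+1)%N.
  apply: leq_trans (size_sum _ _ _) _; apply/bigmax_leqP => i _.
  by rewrite size_polyXn ltnS leq_exp2l // -ltnS.
have p0 : p != 0 by apply/eqP => p0; move: p1; rewrite p0 coef0 => /eqP; rewrite eq_sym oner_eq0.
have [/exists_inP[c cK c1]|/exists_inPn H] :=
  boolP [exists c in frobfix k.+1, trace k.+1 c != 0].
  by exists c => //; rewrite /chi c1.
have allr : all (root p) (enum (frobfix k.+1)).
  by apply/allP => x; rewrite mem_enum => /H; rewrite negbK /root pE.
have := max_poly_roots p0 allr (enum_uniq _).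
rewrite -cardE cardK ltnNge (leq_trans szp) //.
by rewrite expnS mul2n -addnn -addn1 leq_add2l expn_gt0.
Qed.

Lemma chi_orthogonality k lam :
  (0 < k)%N -> #|frobfix k| = (2 ^ k)%N -> lam \in frobfix k ->
  \sum_(c in frobfix k) chi k (c * lam) = if lam == 0 then 2 ^+ k else 0.
Proof.
move=> k0 cardK lamK; case: eqP => [->|/eqP lam0].
  under eq_bigr => c _ do rewrite mulr0 chi0.
  by rewrite sumr_const cardK natrX.
have [c0 c0K c01] := chi_onto k0 cardK.
set s := \sum_(c in _) _.
suff: s = - s by move=> ?; lia.
(* Translating c by c0 / lam multiplies every term by chi(c0) = -1, so the sum equals its
   opposite. *)
have c1K : c0 / lam \in frobfix k by rewrite frobfixM ?frobfixV.
rewrite {1}/s (reindex_inj (addrI (c0 / lam))) /= -sumrN.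
apply: eq_big => [c|c].
  apply/idP/idP => h; last exact: frobfixD.
  by rewrite -[c](addrK (c0 / lam)) oppr_char2 [c + _]addrC frobfixD.
move=> h; have cK : c \in frobfix k.
  by rewrite -[c](addrK (c0 / lam)) oppr_char2 [c + _]addrC frobfixD.
by rewrite mulrDl divfK // chiD ?frobfixM // c01 mulN1r.
Qed.

End Characteristic2.

(** * Quadratic equations over a field and its quadratic extension *)

Lemma prim_root_exists (F : finFieldType) : exists g : F, #|F|.-1.-primitive_root g.
Proof.
have F1 : (0 < #|F|.-1)%N by rewrite -subn1 subn_gt0 finNzRing_gt1.
have /hasP[g _ gP] : has #|F|.-1.-primitive_root (enum [set x : F | x != 0]).
  apply: has_prim_root => //; last 2 first.
  - exact: enum_uniq.
  - rewrite -cardE -(cardC1 (0 : F)) leq_eqVlt; apply/orP; left; apply/eqP.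
    by apply: eq_card => x; rewrite !inE.
  apply/allP => x; rewrite mem_enum inE => x0; apply/unity_rootP.
  apply: (mulfI x0); rewrite mulr1 -exprS prednK ?expf_card //.
  exact: ltnW (finNzRing_gt1 F).
by exists g.
Qed.

Lemma card_unity_roots (F : finFieldType) d :
  (d %| #|F|.-1)%N -> #|[set x : F | x ^+ d == 1]| = d.
Proof.
move=> dvd_d; have [g gP] := prim_root_exists F.
have zP := dvdn_prim_root gP dvd_d; set z := g ^+ _ in zP.
have -> : [set x : F | x ^+ d == 1] = [set z ^+ i | i : 'I_d].
  apply/setP => x; rewrite inE; apply/eqP/imsetP => [/(prim_rootP zP)[i ->]|[i _ ->]].
    by exists i.
  by rewrite exprAC (prim_expr_order zP) expr1n.
rewrite card_imset ?card_ord // => i j /eqP.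
by rewrite (eq_prim_root_expr zP) !modn_small // => /eqP/val_inj.
Qed.

(** Apart from 0, the fixed points are the (2 ^ k - 1)-st roots of unity, and 2 ^ k - 1 divides 2 ^
    n - 1. *)
Lemma card_frobfix (F : finFieldType) n k :
  #|F| = (2 ^ n)%N -> (0 < k)%N -> (k %| n)%N -> #|frobfix F k| = (2 ^ k)%N.
Proof.
move=> cardF k0 /dvdnP[j n_jk].
have k2 : (1 < 2 ^ k)%N by rewrite -{1}(expn0 2) ltn_exp2l.
have -> : frobfix F k = 0 |: [set x : F | x ^+ (2 ^ k).-1 == 1].
  apply/setP => x; rewrite !inE; have [->|x0] := eqVneq x 0.
    by rewrite expr0n expn_eq0 eqxx.
  rewrite -{1}[(2 ^ k)%N]prednK ?exprS; last exact: ltnW.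
  by rewrite -[X in (_ == X) = _]mulr1 (inj_eq (mulfI x0)).
rewrite cardsU1 inE expr0n card_unity_roots; last first.
  by rewrite cardF n_jk mulnC expnM dvdn_pred_predX.
rewrite -subn1 subn_eq0 leqNgt k2 /= eq_sym oner_eq0 /=.
by rewrite subnKC // ltnW.
Qed.

Section QuadraticExtension.

Variable F : finFieldType.
Hypothesis ch2 : 2 \in [pchar F].
Variable k : nat.
Hypothesis cardK : #|frobfix F k| = (2 ^ k)%N.
Hypothesis cardE2 : #|frobfix F (2 * k)| = (2 ^ (2 * k))%N.
Let K := frobfix F k.
Let E := frobfix F (2 * k).
Let r := (2 ^ k)%N.

Lemma rel_conjK z : z \in E -> (z ^+ r) ^+ r = z.
Proof. by rewrite frobfixE -exprM /r -expnD addnn -mul2n => /eqP. Qed.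

Lemma rel_trace_fix z : z \in E -> z + z ^+ r \in K.
Proof.
by move=> zE; rewrite frobfixE -/r exprD2X // -/r rel_conjK // addrC.
Qed.

Lemma rel_norm_fix z : z \in E -> z * z ^+ r \in K.
Proof. by move=> zE; rewrite frobfixE -/r exprMn -/r rel_conjK // mulrC. Qed.

Let sumprod (xy : F * F) := (xy.1 + xy.2, xy.1 * xy.2).
Let trnorm (z : F) := (z + z ^+ r, z * z ^+ r).
Let A (sp : F * F) := [set xy in setX K K | sumprod xy == sp].
Let B (sp : F * F) := [set z in E | trnorm z == sp].

(** Both fibres give roots of X ^ 2 + s X + p. For s = 0 there is one double root, which may count
    once in [A] and once in [B]. For s != 0 the roots from [A] lie in K and those from [B] do not,
    so together they are distinct roots of one quadratic. *)
Lemma quadratic_roots_le2 (sp : F * F) : (#|A sp| + #|B sp| <= 2)%N.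
Proof.
case: sp => s p; have [->|s0] := eqVneq s 0.
  have sqr_inj (x y : F) : x * x = y * y -> x = y.
    by move=> /= xy; apply: (exp2X_inj ch2 (i := 1)); rewrite /= !expr2.
  have A1 : (#|A (0%R, p)| <= 1)%N.
    apply/card_le1_eqP => -[x y] [x' y'].
    rewrite !inE /sumprod /= !xpair_eqE !(addr_eq0_char2 ch2).
    case/andP=> _ /andP[/eqP<- /eqP xp] /andP[_ /andP[/eqP<- /eqP xp']].
    by rewrite (sqr_inj x x') // xp xp'.
  have B1 : (#|B (0%R, p)| <= 1)%N.
    apply/card_le1_eqP => x x'.
    rewrite !inE /trnorm /= !xpair_eqE !(addr_eq0_char2 ch2).
    case/andP=> _ /andP[/eqP<- /eqP xp] /andP[_ /andP[/eqP<- /eqP xp']].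
    by apply: sqr_inj; rewrite xp xp'.
  exact: leq_add A1 B1.
pose f := 'X^2 + s *: 'X + p%:P : {poly F}.
have szf : size f = 3.
  rewrite /f -addrA size_polyDl size_polyXn //.
  rewrite (leq_ltn_trans (size_polyD _ _)) // gtn_max size_polyC.
  by rewrite (leq_ltn_trans (size_scale_leq _ _)) ?size_polyX //; case: (_ != _).
have fE x : f.[x] = x ^+ 2 + s * x + p by rewrite !hornerE.
have root_f x y : x + y = s -> x * y = p -> root f x.
  move=> xs xp; rewrite /root fE -xs -xp; apply/eqP.
  by rewrite mulrDl expr2 addrA (addrr_char2 ch2) add0r mulrC (addrr_char2 ch2).
have fst_inj : {in A (s, p) &, injective fst}.
  case=> [x y] [x' y']; rewrite !inE /sumprod /= !xpair_eqE.
  case/andP=> _ /andP[/eqP xs _] /andP[_ /andP[/eqP xs' _]] /= xx'.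
  by move: xs; rewrite -xs' xx' => /addrI->.
rewrite -(card_in_imset fst_inj) -cardsUI.
have -> : (fst @: A (s, p)) :&: B (s, p) = set0.
  apply/setP => z; rewrite !inE; apply/negP => /andP[/imsetP[[x y]]].
  rewrite !inE /= => /andP[/andP[/eqP xK _] _] -> /andP[_].
  by rewrite /trnorm xpair_eqE /r xK (addrr_char2 ch2) eq_sym (negPf s0).
rewrite cards0 addn0 -ltnS -[X in (_ < X)%N]szf cardE; apply: max_poly_roots.
- by rewrite -size_poly_eq0 szf.
- apply/allP => z; rewrite mem_enum inE => /orP[/imsetP[[x y]]|].
    rewrite inE /sumprod xpair_eqE /= => /andP[_ /andP[/eqP xs /eqP xp]] ->.
    exact: root_f xs xp.
  rewrite inE /trnorm xpair_eqE /= => /andP[_ /andP[/eqP xs /eqP xp]].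
  exact: root_f xs xp.
- exact: enum_uniq.
Qed.

(* Each fibre has at most two points, and both sides have 2 * #|K| ^ 2 points
   in total. *)
Lemma quadratic_roots_eq2 (sp : F * F) : sp \in setX K K -> (#|A sp| + #|B sp|)%N = 2.
Proof.
move=> spK.
have fibers : (\sum_(sp in setX K K) (#|A sp| + #|B sp|) =
               \sum_(sp in setX K K) 2)%N.
  rewrite big_split sum_nat_const cardsX !cardK /=.
  have -> : (\sum_(sp in setX K K) #|A sp| = #|setX K K|)%N.
    rewrite -sum1_card [RHS](partition_big sumprod (mem (setX K K))) /=.
      by apply: eq_bigr => sp' _; rewrite -sum1_card; apply: eq_bigl => x; rewrite !inE.
    case=> x y; rewrite !in_setX /= => /andP[xK yK].
    by rewrite frobfixD // frobfixM.
  have -> : (\sum_(sp in setX K K) #|B sp| = #|E|)%N.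
    rewrite -sum1_card [RHS](partition_big trnorm (mem (setX K K))) /=.
      by apply: eq_bigr => sp' _; rewrite -sum1_card; apply: eq_bigl => x; rewrite !inE.
    by move=> z zE; rewrite in_setX rel_trace_fix // rel_norm_fix.
  by rewrite cardsX cardK cardE2 mul2n -addnn expnD muln2 addnn.
have le2 i : i \in setX K K ->
  (#|A i| + #|B i| <= 2 ?= iff (#|A i| + #|B i| == 2))%N.
  by move=> _; split; first exact: quadratic_roots_le2.
have [_] := leqif_sum le2.
by rewrite fibers eqxx => /esym/forall_inP/(_ _ spK)/eqP.
Qed.

(** Every (s, p) over K arises exactly twice as sum and product, from ordered pairs in K or from an
    element of E and its conjugate. *)
Lemma quadratic_sum (h : F -> F -> int) :
  \sum_(x in K) \sum_(y in K) h (x + y) (x * y)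
    + \sum_(z in E) h (z + z ^+ r) (z * z ^+ r)
  = 2 * \sum_(s in K) \sum_(p in K) h s p.
Proof.
pose h2 sp := h sp.1 sp.2.
rewrite !pair_big_dep /=.
have inK2 (i : F * F) : ((i.1 \in K) && (i.2 \in K)) = (i \in setX K K).
  by case: i => i j; rewrite in_setX.
rewrite (eq_bigl _ _ inK2) [in RHS](eq_bigl _ _ inK2).
rewrite (partition_big sumprod (mem (setX K K))) /=; last first.
  case=> x y; rewrite !in_setX /= => /andP[xK yK].
  by rewrite frobfixD // frobfixM.
rewrite [X in _ + X](partition_big trnorm (mem (setX K K))) /=; last first.
  by move=> z zE; rewrite in_setX rel_trace_fix // rel_norm_fix.
rewrite -big_split mulr_sumr; apply: eq_bigr => sp spK /=.
transitivity (h2 sp *+ #|A sp| + h2 sp *+ #|B sp|).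
  rewrite -!sumr_const; congr (_ + _); apply: eq_big => x.
  - by rewrite !inE.
  - by case/andP=> _ /eqP <-.
  - by rewrite !inE.
  - by case/andP=> _ /eqP <-.
by rewrite -mulrnDr quadratic_roots_eq2 // mulr_natl.
Qed.

End QuadraticExtension.

(** * The quintic quadratic form *)

Lemma big_inj_in (R : Type) (idx : R) (op : Monoid.com_law idx)
    (T : finType) (A : {set T}) (f : T -> T) (g : T -> R) :
  {in A &, injective f} -> {in A, forall x, f x \in A} ->
  \big[op/idx]_(x in A) g (f x) = \big[op/idx]_(x in A) g x.
Proof.
move=> f_inj fA; rewrite -(big_imset g f_inj); apply: eq_bigl.
apply/subset_cardP; first by rewrite card_in_imset.
by apply/subsetP => _ /imsetP[x xA ->]; apply: fA.
Qed.

Section ExponentialSums.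

Variable F : finFieldType.
Hypothesis ch2 : 2 \in [pchar F].

Definition circle k : {set F} := [set z in frobfix F (2 * k) | z * z ^+ (2 ^ k) == 1].

Definition unitsK k : {set F} := [set x in frobfix F k | x != 0].

Definition kloosterman k (a : F) : int :=
  \sum_(x in unitsK k) chi k (a * (x + x^-1)).

Definition quintic (a c : F) := a * (c ^+ 5 + c ^+ 3 + c).

Definition quintic_sum k (a : F) : int := \sum_(c in frobfix F k) chi k (quintic a c).

(* Polar form of [Tr (quintic a c)] is [Tr (c ^+ 4 * radical_poly a y)]. *)
Definition radical_poly (a y : F) :=
  a * y + a ^+ 2 * y ^+ 2 + a ^+ 4 * y ^+ 8 + a ^+ 4 * y ^+ 16.

Definition radical k (a : F) : {set F} :=
  [set y in frobfix F k | radical_poly a y == 0].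

Section FixedDegree.

Variable k : nat.
Hypothesis k0 : (0 < k)%N.
Hypothesis cardK : #|frobfix F k| = (2 ^ k)%N.
Let K := frobfix F k.
Variable a : F.
Hypothesis aK : a \in K.
Hypothesis a0 : a != 0.

Lemma quintic_fix c : c \in K -> quintic a c \in K.
Proof. by move=> cK; rewrite frobfixM ?frobfixD ?frobfixX. Qed.

Lemma radical_poly_fix y : y \in K -> radical_poly a y \in K.
Proof. by move=> yK; rewrite !frobfixD ?frobfixM ?frobfixX. Qed.

Lemma quinticD c y : c \in K -> y \in K ->
  chi k (quintic a (c + y)) =
  chi k (quintic a c) * chi k (quintic a y) * chi k (c ^+ 4 * radical_poly a y).
Proof.
move=> cK yK.
have -> : quintic a (c + y) = quintic a c + quintic a y +
   (a * (c ^+ 4 * y) + a * (c * y ^+ 4) + a * (c ^+ 2 * y) + a * (c * y ^+ 2)).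
  apply/eqP; rewrite -subr_eq0 /quintic; apply/eqP.
  transitivity (2%:R * (a * (2%:R * c ^+ 4 * y + 5%:R * c ^+ 3 * y ^+ 2
     + 5%:R * c ^+ 2 * y ^+ 3 + 2%:R * c * y ^+ 4 + c ^+ 2 * y + c * y ^+ 2))); first by ring.
  by rewrite two_eq0 // mul0r.
have inK i j l : a ^+ l * (c ^+ i * y ^+ j) \in K by rewrite !frobfixM ?frobfixX.
(* Raising a cross term to a power 2 ^ i preserves its trace, and suitable i bring all four to the
   same factor c ^ 4. *)
have e1 : c ^+ 4 * radical_poly a y =
  a * (c ^+ 4 * y) + (a * (c * y ^+ 4)) ^+ (2 ^ 2) + (a * (c ^+ 2 * y)) ^+ (2 ^ 1)
   + (a * (c * y ^+ 2)) ^+ (2 ^ 2).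
  by rewrite /radical_poly; ring.
have M41 := inK 4 1 1; have M14 := inK 1 4 1; have M21 := inK 2 1 1.
have M12 := inK 1 2 1; rewrite !expr1 in M41 M14 M21 M12.
by rewrite e1 !chiD ?chi_frob ?frobfixD ?frobfixX ?quintic_fix.
Qed.

(** In the double sum the second variable is written c + y. By the polar form the sum over c is then
    a complete character sum, which vanishes unless y lies in the radical. *)
Lemma quintic_sum_sqr :
  quintic_sum k a ^+ 2 = 2 ^+ k * \sum_(y in radical k a) chi k (quintic a y).
Proof.
have -> : quintic_sum k a ^+ 2 =
  \sum_(c in K) \sum_(y in K) chi k (quintic a c) * chi k (quintic a (c + y)).
  rewrite expr2 {1}/quintic_sum mulr_suml; apply: eq_bigr => c cK.
  rewrite -mulr_sumr; congr (_ * _).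
  symmetry; apply: (@big_inj_in _ _ _ _ K (fun y => c + y) (fun y => chi k (quintic a y))).
    by move=> y y' _ _ /addrI.
  by move=> y yK; apply: frobfixD.
have -> : \sum_(c in K) \sum_(y in K) chi k (quintic a c) * chi k (quintic a (c + y)) =
  \sum_(y in K) chi k (quintic a y) * \sum_(c in K) chi k (c ^+ 4 * radical_poly a y).
  rewrite exchange_big /=; apply: eq_bigr => y yK; rewrite mulr_sumr.
  apply: eq_bigr => c cK; rewrite quinticD // !mulrA chi_sqr1 mul1r //.
rewrite [RHS]mulr_sumr (bigID (fun y => radical_poly a y == 0)) /=.
rewrite [X in _ + X]big1 ?addr0.
  apply: eq_big => y; first by rewrite [RHS]inE.
  case/andP=> yK /eqP->; rewrite mulrC; congr (_ * _).
  under eq_bigr => c _ do rewrite mulr0 chi0.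
  by rewrite sumr_const cardK natrX.
move=> y /andP[yK ry0].
have -> := @big_inj_in _ _ _ _ K (fun c => c ^+ 4) (fun c => chi k (c * radical_poly a y)).
- by rewrite chi_orthogonality ?radical_poly_fix // (negPf ry0) mulr0.
- by move=> c c' _ _; apply: (@exp2X_inj _ ch2 2).
- by move=> c cK; apply: frobfixX.
Qed.

Lemma card_radical_le16 : (#|radical k a| <= 16)%N.
Proof.
pose p : {poly F} := (a ^+ 4) *: 'X^16 + ((a ^+ 4) *: 'X^8 + ((a ^+ 2) *: 'X^2 + a *: 'X)).
have pE y : p.[y] = radical_poly a y.
  by rewrite /p /radical_poly !(hornerD, hornerZ, hornerXn, hornerX); ring.
(* The linear coefficient a is what keeps this polynomial, of degree at most 16, from being zero. *)
have p1 : p`_1 = a by rewrite /p !coefE /= !mulr0 !add0r mulr1.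
have p0 : p != 0 by apply: contraNneq a0 => p0; rewrite -p1 p0 coef0.
have szp : (size p <= 17)%N.
  apply/leq_sizeP => j j17.
  by rewrite /p !coefE !gtn_eqF ?mulr0 ?addr0 // (leq_trans _ j17).
rewrite -ltnS (leq_trans _ szp) // cardE; apply: max_poly_roots => //.
- apply/allP => y; rewrite mem_enum inE => /andP[_].
  by rewrite /root pE.
- exact: enum_uniq.
Qed.

Lemma radical_poly_add y y' :
  radical_poly a (y + y') = radical_poly a y + radical_poly a y'.
Proof.
have e i := exprD2X ch2 y y' i.
by rewrite /radical_poly (e 1) (e 3) (e 4) !mulrDr; ring.
Qed.

Lemma radicalE y : (y \in radical k a) = (y \in K) && (radical_poly a y == 0).
Proof. by rewrite [LHS]inE. Qed.

Lemma even_card_radical y0 : y0 \in radical k a -> y0 != 0 -> ~~ odd #|radical k a|.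
Proof.
rewrite radicalE => /andP[y0K /eqP ry0] y0n0.
have shiftR y : y \in radical k a -> y0 + y \in radical k a.
  rewrite !radicalE => /andP[yK /eqP ry].
  by rewrite frobfixD //= radical_poly_add ry ry0 addr0.
(* Translation by y0 is an involution without fixed points; [P] selects from each pair the element
   of smaller rank. *)
pose P := [set y : F | (enum_rank y < enum_rank (y0 + y)%R)%N].
have shiftP y : (y0 + y \in P) = (y \notin P).
  rewrite !inE addrA (addrr_char2 ch2) add0r -leqNgt ltn_neqAle.
  have [/val_inj/enum_rank_inj e|//] := eqVneq (val (enum_rank y)) (enum_rank (y0 + y)).
  by move: y0n0; rewrite -[y0](addrK y) -e subrr eqxx.
rewrite -(cardsID P) (_ : #|radical k a :\: P| = #|radical k a :&: P|).
  by rewrite addnn odd_double.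
rewrite -(card_imset _ (addrI y0)); apply: eq_card => y.
rewrite inE; apply/imsetP/andP => [[x]|[yR yP]].
  by rewrite inE => /andP[xP xR] ->; rewrite shiftP xP shiftR.
exists (y0 + y); last by rewrite addrA (addrr_char2 ch2) add0r.
by rewrite inE shiftP negbK yP shiftR.


Qed.

Lemma radical_sum_le16 : `|\sum_(y in radical k a) chi k (quintic a y)| <= 16.
Proof.
apply: le_trans (ler_norm_sum _ _ _) _.
under eq_bigr => y _ do rewrite /chi normrX normrN1 expr1n.
by rewrite sumr_const natz lez_nat card_radical_le16.
Qed.

Lemma radical_sum_even y0 : y0 \in radical k a -> y0 != 0 ->
  (2 %| \sum_(y in radical k a) chi k (quintic a y))%Z.
Proof.
move=> y0R y0n0; have := even_card_radical y0R y0n0; rewrite -dvdn2 => even_card.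
have -> : \sum_(y in radical k a) chi k (quintic a y) =
   \sum_(y in radical k a) (chi k (quintic a y) - 1) + #|radical k a|%:Z.
  by rewrite sumrB sumr_const natz subrK.
rewrite rpredD //; apply: rpred_sum => y _.
by rewrite /chi; case: (_ != _).
Qed.

End FixedDegree.

(* With a trivial radical, [quintic_sum_sqr] would make 2 ^ k a square. *)
Lemma radical_odd_degree k a :
  odd k -> #|frobfix F k| = (2 ^ k)%N -> a \in frobfix F k -> a != 0 ->
  exists2 y, y \in radical k a & y != 0.
Proof.
move=> kodd cardK aK a0; have k0 : (0 < k)%N by case: k kodd {cardK aK}.
have [/exists_inP//|/exists_inPn H] := boolP [exists y in radical k a, y != 0].
have R0 : radical k a = [set 0].
  apply/setP => y; rewrite in_set1; apply/idP/eqP => [/H/negPn/eqP//|->].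
  by rewrite radicalE frobfix0 /radical_poly !expr0n !mulr0 !addr0 eqxx.
have := quintic_sum_sqr k0 cardK aK.
rewrite R0 big_set1 /quintic !expr0n /= !addr0 mulr0 chi0 mulr1 => /(congr1 absz).
rewrite !abszX => /(congr1 (logn 2)); have l2 := logn_prime 2 (isT : prime 2).
rewrite !lognX [X in _ = (k * X)%N]l2 muln1 => e.
by move: kodd; rewrite -e mul2n odd_double.
Qed.

(** The degree 2 k is even, so the nonzero radical element is found over the field of odd degree k
    and carried up. The radical sum is then an even square at most 16, and d is its square root up
    to sign. *)
Lemma quintic_sum_double k a :
  odd k -> #|frobfix F k| = (2 ^ k)%N -> #|frobfix F (2 * k)| = (2 ^ (2 * k))%N ->
  a \in frobfix F k -> a != 0 ->
  exists2 d : int, quintic_sum (2 * k) a = 2 ^+ k * d & d \in [:: 0; 2; -2; 4; -4].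
Proof.
move=> kodd cardK cardE aK a0; have [y yR y0] := radical_odd_degree kodd cardK aK a0.
have k0 : (0 < 2 * k)%N by case: k kodd {cardK cardE aK yR}.
have aE : a \in frobfix F (2 * k) by apply: subsetP aK; apply: frobfixS; apply: dvdn_mull.
have yE : y \in radical (2 * k) a.
  move: yR; rewrite !radicalE => /andP[yK ->]; rewrite andbT.
  by apply: subsetP yK; apply: frobfixS; apply: dvdn_mull.
have := quintic_sum_sqr k0 cardE aE; have := radical_sum_le16 (2 * k) a0.
have := radical_sum_even yE y0.
set N := \sum_(y in _) _; set A := quintic_sum _ _ => even_N N16 A2.
have /dvdzP[d Ad] : (2 ^+ k %| A)%Z.
  by rewrite -(@dvdz_pexp2r _ _ 2) // A2 -exprM mulnC dvdz_mulr.
exists d; first by rewrite mulrC.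
have dN : d ^+ 2 = N.
  apply: (@mulIf _ (2 ^+ (2 * k) : int)); first by rewrite expf_neq0.
  by rewrite [RHS]mulrC -A2 Ad exprMn -exprM mulnC.
have d_even : (2 %| d)%Z.
  by move: even_N; rewrite -dN !dvdzE abszX (Euclid_dvdX _ _ (isT : prime 2)) => /andP[].
case/dvdzP: d_even dN => e -> eN.
have e2 : `|e| <= 2 by nia.
have : [|| e == 0, e == 1, e == -1, e == 2 | e == -2] by lia.
by rewrite !inE; case/or4P => [||| /orP[]] /eqP->.
Qed.

End ExponentialSums.

(** * Sums over the unit circle *)

Section CircleSums.

Variable F : finFieldType.
Hypothesis ch2 : 2 \in [pchar F].
Variable k : nat.
Hypothesis k0 : (0 < k)%N.
Hypothesis cardK : #|frobfix F k| = (2 ^ k)%N.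
Hypothesis cardE2 : #|frobfix F (2 * k)| = (2 ^ (2 * k))%N.
Variable a : F.
Hypothesis aK : a \in frobfix F k.
Hypothesis a0 : a != 0.

(** This is [quadratic_sum] restricted to p = 1: pairs of product 1 in K are (x, 1/x), and elements
    of norm 1 in E have conjugate 1/z. *)
Lemma circle_sum (g : F -> int) :
  \sum_(z in circle F k) g (z + z^-1) + \sum_(x in unitsK F k) g (x + x^-1) =
  2 * \sum_(s in frobfix F k) g s.
Proof.
have := quadratic_sum ch2 cardK cardE2 (fun s p => if p == 1 then g s else 0).
have -> : \sum_(s in frobfix F k) \sum_(p in frobfix F k) (if p == 1 then g s else 0) =
    \sum_(s in frobfix F k) g s.
  apply: eq_bigr => s sK; rewrite (bigD1 1) ?frobfix1 //= eqxx big1 ?addr0 //.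
  by move=> p /andP[_ /negPf->].
move=> <-; rewrite [RHS]addrC; congr (_ + _).
  rewrite -[RHS]big_mkcondr /=; apply: eq_big => z; first by rewrite [LHS]inE.
  rewrite inE => /andP[_ /eqP zz]; rewrite -[in LHS](mulr1 z^-1) -zz mulKf //.
  by apply: contra_eq_neq zz => ->; rewrite mul0r eq_sym oner_eq0.
rewrite [RHS](bigID (fun x => x != 0)) /= [X in _ = _ + X]big1 ?addr0; last first.
  move=> x /andP[_ /negPn/eqP->]; apply: big1 => y _.
  by rewrite mul0r eq_sym oner_eq0.
apply: eq_big => x; first by rewrite [LHS]inE.
rewrite inE => /andP[xK x0].
rewrite (bigD1 x^-1) ?frobfixV //= mulfV // eqxx big1 ?addr0 // => y /andP[_ yx].
case: eqP => // xy; case/eqP: yx.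
by rewrite -[y](mulKf x0) xy mulr1.
Qed.

Lemma chi_circle z i : z \in circle F k ->
  chi (2 * k) (a * z ^+ i) = chi k (a * (z ^+ i + z^-1 ^+ i)).
Proof.
rewrite inE => /andP[_ /eqP zz].
have zr : z ^+ (2 ^ k) = z^-1.
  rewrite -(mulr1 z^-1) -zz mulKf //.
  by apply: contra_eq_neq zz => ->; rewrite mul0r eq_sym oner_eq0.
move: aK; rewrite chi_double // frobfixE exprMn exprAC zr => /eqP->.
by rewrite mulrDr.
Qed.

Lemma circle_sum_linear : \sum_(z in circle F k) chi (2 * k) (a * z) = - kloosterman k a.
Proof.
have full0 : \sum_(s in frobfix F k) chi k (a * s) = 0.
  under eq_bigr => s _ do rewrite mulrC.
  by rewrite chi_orthogonality // (negPf a0).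
have := circle_sum (fun s => chi k (a * s)); rewrite full0 mulr0 => /eqP.
rewrite addr_eq0 => /eqP <-.
by apply: eq_bigr => z zU; have := chi_circle 1 zU; rewrite !expr1.
Qed.

Lemma quintic_dickson x : x != 0 ->
  quintic a (x + x^-1) = a * (x ^+ 5 + x^-1 ^+ 5).
Proof.
move=> x0; rewrite /quintic; congr (_ * _); apply/eqP; rewrite -subr_eq0; apply/eqP.
(* With integer coefficients the two sides differ by an even expression. *)
transitivity (2%:R * (3%:R * (x ^+ 3 + x ^- 3) + 7%:R * (x + x^-1))); last first.
  by rewrite two_eq0 // mul0r.
by field.
Qed.

(** The congruence makes 5 prime to 2 ^ k - 1, so fifth powers permute the units of K and the K-part
    of [circle_sum] is still the Kloosterman sum. *)
Lemma circle_sum_quintic : (2 ^ k = 4 %[mod 5])%N ->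
  \sum_(z in circle F k) chi (2 * k) (a * z ^+ 5) =
    2 * quintic_sum k a - kloosterman k a.
Proof.
move=> k5; apply/eqP; rewrite eq_sym subr_eq; apply/eqP.
rewrite /quintic_sum -circle_sum; congr (_ + _).
  apply: eq_bigr => z zU; rewrite chi_circle // quintic_dickson //.
  move: zU; rewrite inE => /andP[_]; apply: contraTneq => ->.
  by rewrite mul0r eq_sym oner_eq0.
rewrite -[RHS](@big_inj_in _ _ _ _ _ (fun x => x ^+ 5) (fun x => chi k (a * (x + x^-1)))).
- apply: eq_bigr => x; rewrite inE => /andP[_ x0].
  by rewrite quintic_dickson // exprVn.
- move=> x y; rewrite !inE -!frobfixE => /andP[xK x0] /andP[yK y0] xy.
  have wK : x / y \in frobfix F k by rewrite frobfixM ?frobfixV.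
  have w5 : (x / y) ^+ 5 = 1 by rewrite expr_div_n xy divff // expf_neq0.
  move: wK; rewrite frobfixE -(expr_mod _ w5) k5 => /eqP w4.
  have w2 : (x / y) ^+ 2 = 1 by rewrite expr2 -{2}w4 -exprS.
  by apply: (divIf y0); rewrite divff // -w4 (exprM _ 2 2) w2 expr1n.
- by move=> x; rewrite !inE -!frobfixE => /andP[xK x0]; rewrite frobfixX // expf_neq0.
Qed.

(** With s = x + y and p = x y one has x + 1/x + y + 1/y = s + s/p, so both Kloosterman terms come
    from one [h]. The sum over s vanishes unless 1 + 1/p = 0, that is p = 1, where it is 2 ^ k. *)
Lemma kloosterman_double :
  kloosterman k a ^+ 2 + kloosterman (2 * k) a = 2 ^+ k.+1.
Proof.
have := quadratic_sum ch2 cardK cardE2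
  (fun s p => if p == 0 then 0 else chi k (a * (s + s / p))).
have -> : \sum_(s in frobfix F k) \sum_(p in frobfix F k)
   (if p == 0 then 0 else chi k (a * (s + s / p))) = 2 ^+ k.
  rewrite exchange_big /= (bigD1 1) ?frobfix1 //= oner_eq0.
  rewrite [X in _ + X]big1 ?addr0.
    under eq_bigr => s _ do rewrite divr1 addrr_char2 // mulr0 chi0.
    by rewrite sumr_const cardK natrX.
  move=> p /andP[pK p1]; case: eqP => [_|/eqP p0]; first by rewrite big1.
  transitivity (\sum_(s in frobfix F k) chi k (s * (a * (1 + p^-1)))).
    by apply: eq_bigr => s sK; congr (chi _ _); ring.
  rewrite chi_orthogonality ?frobfixM ?frobfixD ?frobfix1 ?frobfixV //.
  by rewrite mulf_eq0 (negPf a0) addr_eq0_char2 //= eq_sym invr_eq1 (negPf p1).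
rewrite -exprS => <-; congr (_ + _).
  rewrite expr2 /kloosterman mulr_suml.
  rewrite [RHS](bigID (fun x => x != 0)) /= [X in _ = _ + X]big1 ?addr0; last first.
    by move=> x /andP[_ /negPn/eqP->]; apply: big1 => y _; rewrite mul0r eqxx.
  apply: eq_big => x; first by rewrite [LHS]inE.
  rewrite inE => /andP[xK x0]; rewrite mulr_sumr.
  rewrite [RHS](bigID (fun x => x != 0)) /= [X in _ = _ + X]big1 ?addr0; last first.
    by move=> y /andP[_ /negPn/eqP->]; rewrite mulr0 eqxx.
  apply: eq_big => y; first by rewrite [LHS]inE.
  rewrite inE => /andP[yK y0].
  rewrite mulf_eq0 (negPf x0) (negPf y0) /= -chiD ?frobfixM ?frobfixD ?frobfixV //.
  by congr (chi _ _); field; rewrite x0 y0.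
rewrite /kloosterman [RHS](bigID (fun x => x != 0)) /= [X in _ = _ + X]big1 ?addr0; last first.
  by move=> x /andP[_ /negPn/eqP->]; rewrite mul0r eqxx.
apply: eq_big => z; first by rewrite [LHS]inE.
rewrite inE => /andP[zE z0].
rewrite mulf_eq0 expf_eq0 (negPf z0) andbF /= chi_double //.
move: aK; rewrite frobfixE exprMn exprD2X // exprVn => /eqP->.
by congr (chi _ _); field; rewrite z0 expf_neq0.
Qed.

End CircleSums.

Lemma kloosterman_odd (F : finFieldType) k (a : F) :
  (0 < k)%N -> #|frobfix F k| = (2 ^ k)%N -> (2 %| kloosterman k a - 1)%Z.
Proof.
move=> k0 cardK.
have card_units : #|unitsK F k|.+1 = (2 ^ k)%N.
  rewrite -cardK (cardsD1 0 (frobfix F k)) frobfix0 add1n; congr _.+1.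
  by apply: eq_card => x; rewrite in_setD1 [LHS]inE andbC.
have -> : kloosterman k a - 1 =
   \sum_(x in unitsK F k) (chi k (a * (x + x^-1)) - 1) + #|unitsK F k|%:Z - 1.
  by rewrite sumrB sumr_const natz subrK.
have -> : #|unitsK F k|%:Z = 2 ^+ k - 1 by rewrite -natrX -card_units; lia.
rewrite -addrA rpredD //; last first.
  case: k k0 {cardK card_units} => // k _; apply/dvdzP; exists (2 ^+ k - 1).
  by rewrite exprS; ring.
by apply: rpred_sum => x _; rewrite /chi; case: (_ != _).
Qed.

(** * Fifth roots of unity *)

(** Multiplication by a nonzero x permutes the nonzero elements of [K]; comparing their products
    gives x ^ (r - 1) = 1. This places the given subfields inside [frobfix]. *)
Lemma subfield_expr (F : finFieldType) r (K : {set F}) x :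
  subfield_of_order r K -> x \in K -> x ^+ r = x.
Proof.
case=> -[K1 KB Kdiv] cardK xK.
have K0 : 0 \in K by rewrite -(subrr 1); apply: KB.
have KM y z : y \in K -> z \in K -> y * z \in K.
  move=> yK zK; rewrite -[z]invrK; apply: (Kdiv) => //.
  by rewrite -[z^-1]mul1r; apply: Kdiv.
have cardK0 : #|K :\ 0| = r.-1 by rewrite -cardK (cardsD1 0 K) K0.
have r0 : (0 < r)%N by rewrite -cardK card_gt0; apply/set0Pn; exists x.
have [->|x0] := eqVneq x 0; first by rewrite expr0n eqn0Ngt r0.
have prod0 : \prod_(y in K :\ 0) y != 0.
  by apply/prodf_neq0 => y; rewrite !inE => /andP[].
have := @big_inj_in _ _ *%R _ (K :\ 0) (fun y => x * y) id
  (in2W (mulfI x0)).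
rewrite big_split prodr_const cardK0 => xX.
rewrite -[r]prednK // exprS -[RHS]mulr1; congr (_ * _).
apply: (mulIf prod0); rewrite mul1r; apply: xX => y.
by rewrite !inE => /andP[y0 yK]; rewrite mulf_neq0 ?KM.
Qed.

(** The d-th power maps the (d e)-th roots of unity onto the e-th ones, each fibre being a coset of
    the d-th roots of unity. *)
Lemma sum_expr_roots (F : finFieldType) d e (g : F -> int) :
  (d * e %| #|F|.-1)%N ->
  \sum_(x | x ^+ (d * e) == 1) g (x ^+ d) = d%:R * \sum_(v | v ^+ e == 1) g v.
Proof.
move=> dvd_de; have [h hP] := prim_root_exists F.
have F1 : (0 < #|F|.-1)%N by rewrite -subn1 subn_gt0 finNzRing_gt1.
have de0 : (0 < d * e)%N by apply: dvdn_gt0 dvd_de.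
have e0 : (0 < e)%N by move: de0; rewrite muln_gt0 => /andP[].
have d0 : (0 < d)%N by move: de0; rewrite muln_gt0 => /andP[].
have [z zP] : exists z : F, (d * e).-primitive_root z.
  by exists (h ^+ (#|F|.-1 %/ (d * e))); apply: dvdn_prim_root.
have zdP := dvdn_prim_root zP (dvdn_mull d (dvdnn e)); rewrite mulnK // in zdP.
rewrite (partition_big (fun x => x ^+ d) (fun v => v ^+ e == 1)) /=; last first.
  by move=> x; rewrite exprM.
rewrite mulr_sumr; apply: eq_bigr => v /eqP ve.
rewrite (eq_bigr (fun => g v)) => [|x /andP[_ /eqP->] //].
have [i vE] := prim_rootP zdP ve.
have z0 : z != 0.
  apply: contra_eq_neq (prim_expr_order zP) => ->.
  by rewrite expr0n eqn0Ngt de0 eq_sym oner_eq0.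
have fibre : [set x | (x ^+ (d * e) == 1) && (x ^+ d == v)] =
    (fun w => z ^+ i * w) @: [set w | w ^+ d == 1].
  apply/setP => x; rewrite inE; apply/andP/imsetP => [[_ /eqP xv]|[w]].
    exists (x / z ^+ i); last by rewrite mulrCA divff ?mulr1 ?expf_neq0.
    by rewrite inE expr_div_n xv vE exprAC divff ?expf_neq0.
  rewrite inE => /eqP w1 ->; rewrite exprM.
  suff -> : (z ^+ i * w) ^+ d = v by rewrite ve.
  by rewrite exprMn w1 mulr1 vE exprAC.
rewrite (eq_bigl (mem [set x | (x ^+ (d * e) == 1) && (x ^+ d == v)])) => [|x]; last first.
  by rewrite /= inE.
rewrite sumr_const fibre card_imset; last exact: mulfI (expf_neq0 i z0).
by rewrite card_unity_roots ?mulr_natl // (dvdn_trans _ dvd_de) ?dvdn_mulr.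
Qed.

Lemma sign_addF2 (u v : 'F_2) : (-1) ^+ (u + v)%R = (-1) ^+ u * (-1) ^+ v :> int.
Proof. by case: u => [[|[|?]] ?] //; case: v => [[|[|?]] ?]. Qed.

Lemma geom5_eq0 (F : fieldType) (x : F) : x ^+ 5 = 1 -> x != 1 -> \sum_(i < 5) x ^+ i = 0.
Proof.
move=> x5 x1; have := subrX1 x 5; rewrite x5 subrr => /esym/eqP.
by rewrite mulf_eq0 subr_eq0 (negPf x1) => /eqP.
Qed.

Section TraceSigns.

Variable F : finFieldType.
Hypothesis ch2 : 2 \in [pchar F].
Variable beta : F.
Hypothesis beta5 : 5.-primitive_root beta.
Variable b : F.
Hypothesis b16 : b \in frobfix F 4.

Lemma beta_fix : beta \in frobfix F 4.
Proof. by rewrite frobfixE -(expr_mod _ (prim_expr_order beta5)). Qed.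

Lemma beta_powers_eq0 j : ~~ (5 %| j)%N -> \sum_(i < 5) (beta ^+ j) ^+ i = 0.
Proof.
move=> j5; apply: geom5_eq0; first by rewrite exprAC (prim_expr_order beta5) expr1n.
by rewrite -(prim_order_dvd beta5).
Qed.

(* Dual basis expansion: the inverse Fourier transform on the fifth roots of unity. *)
Lemma trace_expansion : b = \sum_(i < 5) trace 4 (b * beta ^+ i) * beta ^+ (4 * i).
Proof.
under eq_bigr => i _ do rewrite /trace mulr_suml.
rewrite exchange_big /=.
have inner (j : 'I_4) : \sum_(i < 5) (b * beta ^+ i) ^+ (2 ^ j) * beta ^+ (4 * i) =
    b ^+ (2 ^ j) * \sum_(i < 5) (beta ^+ (2 ^ j + 4)) ^+ i.
  rewrite mulr_sumr; apply: eq_bigr => i _.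
  by rewrite exprMn -mulrA -!exprM -exprD; congr (_ * _ ^+ _); lia.
under eq_bigr => j _ do rewrite inner.
(* Among the exponents 2 ^ j + 4 with j < 4 only the one for j = 0 is divisible by 5. *)
rewrite big_ord_recl [X in _ = _ + X]big1 ?addr0 => [|j _].
  rewrite [beta ^+ _](prim_expr_order beta5); under eq_bigr => i _ do rewrite expr1n.
  have five1 : 5%:R = 1 :> F by rewrite (natrD _ 4 1) (natrM _ 2 2) two_eq0 // mul0r add0r.
  by rewrite sumr_const card_ord five1 mulr1 expr1.
by rewrite beta_powers_eq0 ?mulr0 //; case: j => [[|[|[|]]]].
Qed.

(** The five traces t i of b beta ^ i sum to 0, so an even number of them equal 1. The only sign
    pattern missing from the list, (-1, -2), has t 0 = 1 and exactly one t i = 0; since the powers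
    of beta sum to 0, the expansion then gives b = beta ^ (4 i), which is excluded. *)
Lemma trace_signs :
  (forall i, (1 <= i <= 4)%N -> b != beta ^+ i) ->
  (chi 4 b, \sum_(i < 4) chi 4 (b * beta ^+ i.+1)) \in
    [:: (1, 4); (-1, 2); (1, 0); (1, -4)].
Proof.
move=> bN.
pose t i := trace 4 (b * beta ^+ i).
have t01 i : t i = 0 \/ t i = 1.
  by apply/pred2P; rewrite trace01 // frobfixM ?frobfixX ?beta_fix.
have sum_beta : \sum_(i < 5) beta ^+ i = 0.
  by have := @beta_powers_eq0 1 isT; rewrite expr1.
have sum_t : \sum_(i < 5) t i = 0.
  rewrite /t -(big_morph (trace 4) (fun x y => traceD ch2 4 x y) (trace0 F 4)).
  by rewrite -mulr_sumr sum_beta mulr0 trace0.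
have chiE i : chi 4 (b * beta ^+ i) = (-1) ^+ (t i != 0) by [].
have bE : b = \sum_(i < 5) t i * beta ^+ (4 * i) := trace_expansion.
rewrite -[X in chi 4 X]mulr1 -(expr0 beta) chiE.
under eq_bigr => i _ do rewrite chiE.
have betaM k : beta ^+ k = beta ^+ (k %% 5) by rewrite (expr_mod _ (prim_expr_order beta5)).
move: sum_beta sum_t bE; rewrite !big_ord_recr !big_ord0 /= !add0r !muln1 expr0.
rewrite (betaM (4 * 2)%N : _ = beta ^+ 3) (betaM (4 * 3)%N : _ = beta ^+ 2).
rewrite (betaM (4 * 4)%N : _ = beta ^+ 1) mulr1.
move=> sum_beta; have excluded i : (1 <= i <= 4)%N -> b + beta ^+ i = 0 -> False.
  by move=> /bN bi /eqP; rewrite addr_eq0_char2 // (negPf bi).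
case: (t01 0) => ->; case: (t01 1) => ->; case: (t01 2) => ->; case: (t01 3) => ->;
  case: (t01 4) => ->; rewrite !(add0r, addr0, addrr_char2 ch2) => /eqP;
  rewrite ?oner_eq0 ?eqxx // => _ bE'; exfalso.
- by apply: (excluded 4) => //; rewrite -sum_beta {1}bE'; ring.
- by apply: (excluded 3) => //; rewrite -sum_beta {1}bE'; ring.
- by apply: (excluded 2) => //; rewrite -sum_beta {1}bE'; ring.
- by apply: (excluded 1) => //; rewrite -sum_beta {1}bE'; ring.
Qed.

End TraceSigns.

(** * The Diophantine equations *)

Lemma mod_cases (N : nat) (t : int) : (0 < N)%N ->
  exists (u : int) (c : nat), (c < N)%N /\ t = N%:Z * u + c%:Z.
Proof.
move=> N0; exists (t %/ N)%Z, `|(t %% N)%Z|%N.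
have N0' : N%:Z != 0 by lia.
have m0 := modz_ge0 t N0'; have mN := ltz_mod t N0'.
split; first by lia.
by rewrite gez0_abs // [in LHS](divz_eq t N) mulrC.
Qed.

Lemma sqr_odd_mod8 (t : int) : (2 %| t - 1)%Z -> exists v, t ^+ 2 = 8 * v + 1.
Proof.
case/dvdzP=> u tu; have -> : t = 2 * u + 1 by lia.
have [w [[|[|c]] [// c2 ->]]] := mod_cases u (isT : (0 < 2)%N).
- by exists (w * (2 * w + 1)); ring.
- by exists ((2 * w + 1) * (w + 1)); ring.
Qed.

Lemma odd_ge3_double k : odd k -> (3 <= k)%N -> exists j, k = (2 * j + 3)%N.
Proof. by move=> k_odd k3; exists (k - 3)./2; lia. Qed.

(** The case a = 0: here P0 = P1 >= 13, while (e0 + e1) P0 = 1. *)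
Lemma equal_class_sums_arith (Q : nat) (P0 P1 e0 e1 : int) : (64 <= Q)%N ->
  Q.+1%:Z = 5 * P0 -> Q.+1%:Z = P0 + 4 * P1 ->
  (e0, e1) \in [:: (1, 4); (-1, 2); (1, 0); (1, -4)] ->
  e0 * P0 + e1 * P1 = 1 -> False.
Proof.
move=> Q64 P0E P1E; have -> : P1 = P0 by lia.
by rewrite !inE => /or4P[] /eqP[-> ->] L; lia.
Qed.

(* [q] is 2 ^ m1, written with m1 = 2 j + 3 and s = 2 ^ j. *)
Lemma not_hyperbent_arith (s t d P0 P1 e0 e1 : int) (q := 8 * s ^+ 2) (S := t ^+ 2 - 2 * q) :
  1 <= s -> ~~ (3 %| s)%Z -> (2 %| t - 1)%Z -> d \in [:: 0; 2; -2; 4; -4] ->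
  P0 + 4 * P1 = S -> 5 * P0 = 2 * (q * d) + S ->
  (e0, e1) \in [:: (1, 4); (-1, 2); (1, 0); (1, -4)] ->
  e0 * P0 + e1 * P1 = 1 -> False.
Proof.
move=> s1 s3 /sqr_odd_mod8[v tv] dP PS P5.
have [s' s2] : exists s' : int, s ^+ 2 = 3 * s' + 1.
  have [u [[|[|[|c]]] [// c3 su]]] := mod_cases s (isT : (0 < 3)%N).
  - by case/negP: s3; apply/dvdzP; exists u; rewrite su; lia.
  - by exists (3 * u ^+ 2 + 2 * u); rewrite su; ring.
  - by exists (3 * u ^+ 2 + 4 * u + 1); rewrite su; ring.
rewrite !inE => /or4P[] /eqP[-> ->] L.
(* Signs (1, 4): S = 1, so 2 q = (4 s) ^ 2 and 2 q + 1 = t ^ 2 are consecutive positive squares. *)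
- have t2 : t ^+ 2 = (4 * s) ^+ 2 + 1 by rewrite /S /q in PS; lia.
  have : `|t| ^+ 2 = (4 * s) ^+ 2 + 1 by rewrite real_normK ?num_real.
  have := normr_ge0 t; move: `|t| => u u0 u2.
  by have [?|?] := lerP u (4 * s); nia.
(* Signs (-1, 2) give t ^ 2 = (3 d + 2) q + 5, and (1, 0) below gives t ^ 2 = (2 - 2 d) q + 5; as 8
   divides q, both contradict t ^ 2 = 1 modulo 8. *)
- rewrite /S /q tv in PS P5; move: dP; rewrite !inE.
  by case/or4P => [||| /orP[]] /eqP dE; rewrite dE in P5; lia.
- rewrite /S /q tv in PS P5; move: dP; rewrite !inE.
  by case/or4P => [||| /orP[]] /eqP dE; rewrite dE in P5; lia.
(* Signs (1, -4) give 3 t ^ 2 = (4 d + 6) q - 5. Negative d fail by sign, d = 0 and d = 2 fail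
   modulo 3, where q = 2, and only d = 4 is left. *)
rewrite /S /q in PS P5; move: dP; rewrite !inE.
have t0 : 0 <= t ^+ 2 by apply: sqr_ge0.
have q1 : 1 <= s ^+ 2 by nia.
case/or4P => [||| /orP[]] /eqP dE; rewrite dE in P5; try lia.
(* Here 3 t ^ 2 = 22 q - 5, but 2 is not a square modulo 11. *)
have [u [c [c11 tu]]] := mod_cases t (isT : (0 < 11)%N).
have : 3 * (11 * (11 * u ^+ 2 + 2 * u * c%:Z) + c%:Z ^+ 2) = 22 * 8 * s ^+ 2 - 5.
  rewrite (_ : 11 * _ + _ = t ^+ 2); first lia.
  by rewrite tu; ring.
move: (11 * u ^+ 2 + _) => w {tu}.
by do 11 (case: c c11 => [_|c c11]; first by rewrite ?expr0n /= => *; lia).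
Qed.

(** * Reduction to the circle *)

Lemma exp2_odd_mod5 k : odd k -> (2 ^ k %% 5 = 2 \/ 2 ^ k %% 5 = 3)%N.
Proof.
move=> k_odd; rewrite -(odd_double_half k) k_odd; elim: k./2 => [|j IHj]; first by left.
rewrite doubleS !add1n !expnS in IHj *; move: (2 ^ _)%N IHj => x; lia.
Qed.

Lemma exp2_double_odd_mod5 k : odd k -> (2 ^ (2 * k) %% 5 = 4)%N.
Proof.
move=> k_odd; rewrite mul2n -addnn expnD -modnMm.
by case: (exp2_odd_mod5 k_odd) => ->.
Qed.

Lemma five_mul_divn k : odd k -> (5 * ((2 ^ (2 * k)).+1 %/ 5) = (2 ^ (2 * k)).+1)%N.
Proof. by move/exp2_double_odd_mod5 => E; lia. Qed.

Lemma predn_sqr x : (0 < x)%N -> ((x * x).-1 = x.-1 * x.+1)%N.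
Proof. by rewrite -!subn1; nia. Qed.

Section CircleClasses.

Variable F : finFieldType.
Hypothesis ch2 : 2 \in [pchar F].
Variable k : nat.
Hypothesis k_odd : odd k.
Let m := (2 * k)%N.
Let n := (2 * m)%N.
Hypothesis cardF : #|F| = (2 ^ n)%N.
Variables a b : F.
Hypothesis aK : a \in frobfix F k.
Let e := ((2 ^ m).+1 %/ 5)%N.
Variable beta : F.
Hypothesis beta5 : 5.-primitive_root beta.

Lemma frobfix_full : frobfix F n = setT.
Proof. by apply/setP => x; rewrite !inE -cardF expf_card eqxx. Qed.

Lemma pred_cardF : (#|F|.-1 = (2 ^ m).-1 * (5 * e))%N.
Proof.
by rewrite cardF /n mul2n -addnn expnD five_mul_divn // predn_sqr ?expn_gt0.
Qed.

Lemma circleE v : (v \in circle F m) = (v ^+ (5 * e) == 1).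
Proof. by rewrite inE -/n frobfix_full in_setT /e five_mul_divn // exprS. Qed.

(** For w = beta ^ i this is the partial sum P_i. *)
Definition circle_class (w : F) : int :=
  \sum_(v in circle F m | v ^+ e == w) chi n (a * v).

Definition circle_binomial : int :=
  \sum_(v in circle F m) chi n (a * v) * chi 4 (b * v ^+ e).

(** The map v -> v ^ (2 ^ k) permutes the circle, preserves chi(a v) because it fixes a, and carries
    the class of w to that of w ^ (2 ^ k). *)
Lemma circle_class_frob w : circle_class (w ^+ (2 ^ k)) = circle_class w.
Proof.
rewrite /circle_class !big_mkcondr /=.
rewrite -(@big_inj_in _ _ _ _ (circle F m) (fun v => v ^+ (2 ^ k))
  (fun v => if v ^+ e == w ^+ (2 ^ k) then chi n (a * v) else 0)).
- apply: eq_bigr => v vU; rewrite exprAC (inj_eq (exp2X_inj ch2 (i := k))).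
  have aq : a ^+ (2 ^ k) = a by apply/eqP; rewrite -frobfixE.
  by rewrite -{1}aq -exprMn chi_frob // frobfix_full inE.
- by move=> x y _ _; apply: exp2X_inj.
- by move=> v; rewrite !circleE exprAC => /eqP->; rewrite expr1n.
Qed.

Lemma circle_class_beta i : (1 <= i <= 4)%N -> circle_class (beta ^+ i) = circle_class beta.
Proof.
have step j : circle_class (beta ^+ (j * 2 ^ k %% 5)) = circle_class (beta ^+ j).
  by rewrite (expr_mod _ (prim_expr_order beta5)) exprM circle_class_frob.
have step' j : circle_class (beta ^+ (j * (2 ^ k %% 5) %% 5)) = circle_class (beta ^+ j).
  by rewrite modnMmr step.
move=> i14; rewrite -[in RHS](expr1 beta).
(* Both 2 and 3 generate the units modulo 5: the exponents run through 1, 2, 4, 3 or through 1, 3,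
   4, 2. *)
case: (exp2_odd_mod5 k_odd) => E; rewrite E in step'.
  have /= s1 := step' 1; have /= s2 := step' 2; have /= s4 := step' 4.
  by move: i14; case: i => [|[|[|[|[|i]]]]] //; rewrite -?s1 -?s2 -?s4.
have /= s1 := step' 1; have /= s2 := step' 3; have /= s4 := step' 4.
by move: i14; case: i => [|[|[|[|[|i]]]]] //; rewrite -?s1 -?s2 -?s4.
Qed.

Lemma circle_partition (h : F -> int) :
  \sum_(v in circle F m) chi n (a * v) * h (v ^+ e) =
  \sum_(i < 5) h (beta ^+ i) * circle_class (beta ^+ i).
Proof.
(* The i < 5 with v ^ e = beta ^ i; on the circle v ^ e is a fifth root of unity, so the default
   [ord0] is never reached there. *)
pose ind v := if insub (index (v ^+ e) [seq beta ^+ i | i <- iota 0 5]) is Some i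
  then i else ord0 : 'I_5.
have indP v : v \in circle F m -> forall i : 'I_5, (ind v == i) = (v ^+ e == beta ^+ i).
  rewrite circleE mulnC exprM => /eqP/(prim_rootP beta5)[j vj] i.
  have uniq_beta : uniq [seq beta ^+ i | i <- iota 0 5].
    rewrite map_inj_in_uniq ?iota_uniq // => x y; rewrite !mem_iota /= => x5 y5 /eqP.
    by rewrite (eq_prim_root_expr beta5) !modn_small // => /eqP.
  have -> : ind v = j.
    rewrite /ind vj -[X in index (beta ^+ X)](nth_iota 0 0 (ltn_ord j)) ?add0n.
    rewrite -(nth_map _ 0) ?size_iota // index_uniq ?size_map ?size_iota //.
    by rewrite valK.
  by rewrite vj (eq_prim_root_expr beta5) !modn_small.
rewrite (partition_big ind xpredT) //=; apply: eq_bigr => i _.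
rewrite /circle_class mulr_sumr; apply: eq_big => v.
  by case vU: (v \in circle F m) => //=; apply: indP.
by case/andP=> vU; rewrite indP // => /eqP->; rewrite mulrC.
Qed.

Lemma circle_binomialE :
  circle_binomial = chi 4 b * circle_class 1
    + (\sum_(i < 4) chi 4 (b * beta ^+ i.+1)) * circle_class beta.
Proof.
rewrite /circle_binomial (circle_partition (fun w => chi 4 (b * w))).
rewrite big_ord_recl expr0 mulr1 mulr_suml; congr (_ + _).
by apply: eq_bigr => i _; rewrite lift0 circle_class_beta // ltn_ord.
Qed.

Lemma circle_sum_classes :
  \sum_(v in circle F m) chi n (a * v) = circle_class 1 + 4 * circle_class beta.
Proof.
have := circle_partition (fun=> 1).
under eq_bigr => v _ do rewrite mulr1.
move=> ->; rewrite big_ord_recl expr0 mul1r; congr (_ + _).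
rewrite (eq_bigr (fun=> circle_class beta)).
  by rewrite sumr_const card_ord mulr_natl.
by move=> i _; rewrite lift0 mul1r circle_class_beta // ltn_ord.
Qed.

(** The circle has order 5 e, so fifth powers map it five-to-one onto the e-th roots of unity, which
    form the class of 1. *)
Lemma circle_sum_fifth :
  \sum_(v in circle F m) chi n (a * v ^+ 5) = 5 * circle_class 1.
Proof.
rewrite (eq_bigl _ _ circleE).
rewrite (sum_expr_roots (fun v => chi n (a * v))); last by rewrite pred_cardF dvdn_mull.
congr (_ * _); apply: eq_bigl => v; rewrite circleE.
by case: eqP => [ve|_]; rewrite ?andbF // mulnC exprM ve expr1n eqxx.
Qed.

(** As (2 ^ n - 1) / 5 = (2 ^ m - 1) e, the function depends on x only through x ^ (2 ^ m - 1),
    which maps the nonzero x onto the circle with fibres of size 2 ^ m - 1. The leading 1 is the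
    term x = 0. *)
Lemma fab_sum_circle :
  \sum_(x : F) (-1) ^+ (fab n m a b x) = 1 + ((2 ^ m).-1)%:R * circle_binomial.
Proof.
have m0 : (0 < m)%N by rewrite /m; case: k k_odd.
have m2 : (1 < 2 ^ m)%N by rewrite -{1}(expn0 2) ltn_exp2l.
have e_div : ((2 ^ n - 1) %/ 5 = (2 ^ m).-1 * e)%N.
  by rewrite subn1 -cardF pred_cardF mulnCA mulKn.
have e0 : (0 < e)%N by rewrite -(@ltn_pmul2l 5) // muln0 five_mul_divn.
rewrite (bigD1 0) //=; congr (_ + _).
  rewrite sign_addF2 !Tr1_chi e_div !expr0n subn_eq0 leqNgt m2 muln_eq0.
  rewrite -subn1 subn_eq0 leqNgt m2 eqn0Ngt e0 /= !mulr0 !chi0 //.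
rewrite /circle_binomial (eq_bigl _ _ circleE).
rewrite -(sum_expr_roots (fun v => chi n (a * v) * chi 4 (b * v ^+ e))); last first.
  by rewrite pred_cardF.
apply: eq_big => x.
  apply/idP/idP => [x0|]; last first.
    apply: contraTneq => ->; rewrite expr0n -pred_cardF -subn1 subn_eq0 leqNgt.
    by rewrite finNzRing_gt1 eq_sym oner_eq0.
  rewrite -pred_cardF; apply/eqP; apply: (mulfI x0).
  by rewrite mulr1 -exprS prednK ?expf_card // ltnW // finNzRing_gt1.
by rewrite sign_addF2 !Tr1_chi subn1 e_div -exprM.
Qed.

End CircleClasses.

(** With Q = 2 ^ m, the value at w = 0 reads 1 + (Q - 1) L = Q or -Q. The second would make Q - 1 >=
    3 divide Q + 1, hence 2. *)
Lemma bent_at_zero (F : finFieldType) m (f : F -> 'F_2) (L : int) :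
  (2 <= m)%N -> bent (2 * m) f ->
  \sum_(x : F) (-1) ^+ (f x) = 1 + ((2 ^ m).-1)%:R * L -> L = 1.
Proof.
move=> m2 /(_ 0) /=.
have -> : (2 * m)./2 = m by rewrite mul2n doubleK.
under eq_bigr => x _ do rewrite sign_addF2 Tr1_chi mul0r chi0 mulr1.
move=> + sumE; rewrite sumE -natrX -subn1 natrB ?expn_gt0 //.
have : (4 <= 2 ^ m)%N by rewrite -{1}[4%N]/(2 ^ 2)%N leq_exp2l.
move: (2 ^ m)%N => Q Q4; rewrite natz => -[E|E].
  have Q1 : Q%:Z - 1 != 0 by lia.
  by apply: (mulfI Q1); lia.
by have [?|?] := lerP L (-2); nia.
Qed.

Theorem theorem4 (n m m1 : nat) (hn : n = (2 * m)%N) (hm : m = (2 * m1)%N)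
  (hm1 : m1 = 1 %[mod 2]) (hm1_ge3 : (3 <= m1)%N)
  (F : finFieldType) (hF : #|F| = (2 ^ n)%N)
  (F16 : {set F}) (hF16 : subfield_of_order 16 F16)
  (Fm1 : {set F}) (hFm1 : subfield_of_order (2 ^ m1) Fm1)
  (beta : F) (hbeta_mem : beta \in F16) (hbeta : 5.-primitive_root beta)
  (b : F) (hb : b \in F16 :\: [set beta ^+ i | i : 'I_5 & (1 <= i <= 4)%N])
  (a : F) (ha : a \in Fm1) :
  ~ hyper_bent n (fab n m a b).
Proof.
case=> bent_f _; subst n m.
have ch2 := card_finPcharP hF (isT : prime 2).
have m1_odd : odd m1 by move: hm1; rewrite !modn2; case: (odd m1).
have m1_gt0 : (0 < m1)%N by apply: leq_trans hm1_ge3.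
have cardK : #|frobfix F m1| = (2 ^ m1)%N.
  by apply: (card_frobfix hF) => //; do 2 apply: dvdn_mull.
have cardM : #|frobfix F (2 * m1)| = (2 ^ (2 * m1))%N.
  by apply: (card_frobfix hF); [rewrite muln_gt0 | apply: dvdn_mull].
have cardE : #|frobfix F (2 * (2 * m1))| = (2 ^ (2 * (2 * m1)))%N.
  by apply: (card_frobfix hF); rewrite ?muln_gt0.
have aK : a \in frobfix F m1 by rewrite frobfixE (subfield_expr hFm1).
have aM : a \in frobfix F (2 * m1) by apply: subsetP aK; apply: frobfixS; apply: dvdn_mull.
case/setDP: hb => b16 bN.
have bK : b \in frobfix F 4 by rewrite frobfixE (subfield_expr hF16).
have signs := trace_signs ch2 hbeta bK _.
have {signs}/signs signs : forall i, (1 <= i <= 4)%N -> b != beta ^+ i.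
  move=> i i14; apply: contraNneq bN => ->; apply/imsetP.
  have i5 : (i < 5)%N by case/andP: i14.
  by exists (Ordinal i5); rewrite ?inE.
have m2 : (2 <= 2 * m1)%N := leq_mul (leqnn 2) m1_gt0.
have L1 := bent_at_zero m2 bent_f (fab_sum_circle m1_odd hF a b).
rewrite (circle_binomialE ch2 m1_odd hF b aK hbeta) in L1.
have S_E := circle_sum_classes ch2 m1_odd hF aK hbeta.
have P_E := circle_sum_fifth m1_odd hF a.
set P0 := circle_class _ a 1 in L1 S_E P_E; set P1 := circle_class _ a beta in L1 S_E.
have M0 : (0 < 2 * m1)%N by rewrite muln_gt0.
(* For a = 0 every character value is 1, and both circle sums equal the order of the circle. *)
have [a0|a0] := eqVneq a 0.
  have card_circle : #|circle F (2 * m1)| = (2 ^ (2 * m1)).+1.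
    pose d := (5 * ((2 ^ (2 * m1)).+1 %/ 5))%N.
    have -> : circle F (2 * m1) = [set v | v ^+ d == 1].
      by apply/setP => v; rewrite (circleE m1_odd hF) inE.
    rewrite card_unity_roots; first exact: five_mul_divn.
    by rewrite (pred_cardF m1_odd hF) dvdn_mull.
  have all1 i : \sum_(v in circle F (2 * m1)) chi (2 * (2 * m1)) (a * v ^+ i) =
      ((2 ^ (2 * m1)).+1)%:Z.
    rewrite (eq_bigr (fun=> 1)) => [|v _]; last by rewrite a0 mul0r chi0.
    by rewrite sumr_const card_circle natz.
  rewrite all1 in P_E; rewrite (eq_bigr (fun v => chi (2 * (2 * m1)) (a * v ^+ 1))) // in S_E.
  rewrite all1 in S_E.
  have Q64 : (2 ^ 6 <= 2 ^ (2 * m1))%N by rewrite leq_exp2l ?(leq_mul (leqnn 2) hm1_ge3).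
  exact: (equal_class_sums_arith Q64 P_E S_E signs L1).
have [d A_E dP] := quintic_sum_double ch2 m1_odd cardK cardM aK a0.
have M5 : (2 ^ (2 * m1) = 4 %[mod 5])%N by rewrite exp2_double_odd_mod5.
(* This turns the Kloosterman sum over F_Q, which appears in both circle sums, into 2 q - t ^ 2. *)
have T_E := kloosterman_double ch2 m1_gt0 cardK cardM aK a0.
rewrite (circle_sum_linear ch2 M0 cardM cardE aM a0) in S_E.
rewrite (circle_sum_quintic ch2 cardM cardE aM M5) A_E in P_E.
have [j m1E] := odd_ge3_double m1_odd hm1_ge3.
have qE : 2 ^+ m1 = 8 * (2 ^+ j) ^+ 2 :> int.
  by rewrite m1E exprD mulnC exprM mulrC.
apply: (@not_hyperbent_arith (2 ^+ j) (kloosterman m1 a) d P0 P1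
  (chi 4 b) (\sum_(i < 4) chi 4 (b * beta ^+ i.+1))) => //.
- by rewrite exprn_ege1.
- by rewrite dvdzE abszX Euclid_dvdX.
- exact: kloosterman_odd.
- by rewrite -S_E -qE -exprS -T_E; ring.
- by rewrite -P_E -qE -exprS -T_E; ring.
Qed.
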